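(* Let $\mathcal{I}_{Lip}^{1}$ and $\mathcal{I}_{Lip}^{2}$ be Lipschitz operator ideals. Then $$\overline{[\mathcal{I}_{Lip}^{1},\mathcal{I}_{Lip}^{2}]}\subset[\overline{\mathcal{I}_{Lip}^{1}},\overline{\mathcal{I}_{Lip}^{2}}].$$ Consequently, if $\mathcal{I}_{Lip}^{1}$ and $\mathcal{I}_{Lip}^{2}$ are closed, then $[\mathcal{I}_{Lip}^{1},\mathcal{I}_{Lip}^{2}]$ is closed too.
   Context: Let $\mathbb{K}$ be $\mathbb{R}$ or $\mathbb{C}$; all Banach spaces are over $\mathbb{K}$. A pointed metric space is a metric space with a distinguished base point $0$. $Lip_0(X,Y)$ is the set of Lipschitz maps $T:X\to Y$ with $T(0)=0$ and $Lip(T)$ is the least Lipschitz constant; for a Banach space $E$, $Lip_0(X,E)$ is a Banach space under $Lip(\cdot)$; $X^{\#}=Lip_0(X,\mathbb{K})$. $\mathcal{L}(E,F)$ is the space of bounded linear operators. A map $T:X_1\times X_2\to E$ belongs to $BLip_0(X_1,X_2;E)$ if $T(x_1,0)=T(0,x_2)=0$ for all $x_1,x_2$ and there is $C>0$ with $\|T(x_1,x_2)-T(x_1,x_2')-T(x_1',x_2)+T(x_1',x_2')\|\le C\,d(x_1,x_1')d(x_2,x_2')$ for all $x_1,x_1'\in X_1$, $x_2,x_2'\in X_2$. The least such $C$ is $BLip(T)$, a Banach space norm on $BLip_0(X_1,X_2;E)$. A Lipschitz operator ideal $\mathcal{I}_{Lip}$ is a subclass of $Lip_0$ such that for every pointed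 metric space $X$ and Banach space $E$ the components $\mathcal{I}_{Lip}(X,E):=Lip_0(X,E)\cap\mathcal{I}_{Lip}$ satisfy: (i) $\mathcal{I}_{Lip}(X,E)$ is a linear subspace of $Lip_0(X,E)$; (ii) $vg:x\mapsto g(x)v$ belongs to $\mathcal{I}_{Lip}(X,E)$ for $v\in E$, $g\in X^{\#}$; (iii) if $S\in Lip_0(Y,X)$, $T\in\mathcal{I}_{Lip}(X,E)$, $w\in\mathcal{L}(E,F)$, then $wTS\in\mathcal{I}_{Lip}(Y,F)$. Each $T\in BLip_0(X_1,X_2;E)$ has associated maps $T_1\in Lip_0(X_1,Lip_0(X_2,E))$ and $T_2\in Lip_0(X_2,Lip_0(X_1,E))$, $T_1(x_1)(x_2)=T(x_1,x_2)=T_2(x_2)(x_1)$. $T\in[\mathcal{I}_{Lip}^{1},\mathcal{I}_{Lip}^{2}](X_1,X_2;E)$ iff $T_1\in\mathcal{I}_{Lip}^{1}(X_1,Lip_0(X_2,E))$ and $T_2\in\mathcal{I}_{Lip}^{2}(X_2,Lip_0(X_1,E))$. Closures: $\overline{\mathcal{I}_{Lip}}(X,E)$ is the closure of $\mathcal{I}_{Lip}(X,E)$ in $(Lip_0(X,E),Lip(\cdot))$; for a class $\mathcal{I}_{BLip}$ of two-Lipschitz operators, $\overline{\mathcal{I}_{BLip}}(X_1,X_2;E)$ is the closure of $\mathcal{I}_{BLip}(X_1,X_2;E)$ in $(BLip_0(X_1,X_2;E),BLip(\cdot))$. An ideal is closed if it equals its closure. Inclusions and equalities of classes are componentwise. 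*)

(* Defs.v *)
From HB Require Import structures.
From mathcomp Require Import all_boot all_order all_algebra.
From mathcomp Require Import complex.
From mathcomp Require Import all_classical all_reals all_analysis.

Set Implicit Arguments.
Unset Strict Implicit.
Unset Printing Implicit Defensive.

Import Order.TTheory GRing.Theory Num.Theory.
Import numFieldNormedType.Exports.

Local Open Scope classical_set_scope.
Local Open Scope ring_scope.

(** Norms of the library take their values in the scalar field, so over the
    complex numbers they are complex (nonnegative) numbers. Distances and
    Lipschitz constants are kept real; [of_real], [to_real] and [rnorm] make
    the conversion. *)

Inductive scalar_kind := RealScalars | ComplexScalars.

Definition scalar_field (R : realType) (k : scalar_kind) : numFieldType :=
  match k with
  | RealScalars => R
  | ComplexScalars => R[i]
  end.

Definition of_real (R : realType) (k : scalar_kind) : R -> scalar_field R k :=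
  match k return R -> scalar_field R k with
  | RealScalars => id
  | ComplexScalars => real_complex R
  end.
Arguments of_real {R k}.

Definition to_real (R : realType) (k : scalar_kind) : scalar_field R k -> R :=
  match k return scalar_field R k -> R with
  | RealScalars => id
  | ComplexScalars => @complex.Re R
  end.
Arguments to_real {R k}.

Section scalars.
Context {R : realType} {k : scalar_kind}.
Local Notation K := (scalar_field R k).

Lemma of_realK : cancel (@of_real R k) to_real.
Proof. by case: k. Qed.

Lemma to_realK (x : K) : 0 <= x -> of_real (to_real x) = x.
Proof. by case: k x => //= x x0; exact/RRe_real/ger0_real. Qed.

Lemma of_realD (x y : R) : of_real (x + y) = of_real x + of_real y :> K.
Proof. by case: k => //; exact: rmorphD. Qed.

Lemma of_realM (x y : R) : of_real (x * y) = of_real x * of_real y :> K.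
Proof. by case: k => //; exact: rmorphM. Qed.

Lemma of_real0 : of_real 0 = 0 :> K.
Proof. by case: k. Qed.

Lemma of_real_le (x y : R) : (of_real x <= of_real y :> K) = (x <= y).
Proof. by case: k => //=; rewrite lecR. Qed.

Lemma of_real_lt (x y : R) : (of_real x < of_real y :> K) = (x < y).
Proof. by case: k => //=; rewrite ltcR. Qed.

Lemma of_real_inj : injective (@of_real R k).
Proof. exact: can_inj of_realK. Qed.

Lemma to_real_norm_ge0 (a : K) : 0 <= to_real `|a|.
Proof. by rewrite -(@of_real_le) of_real0 to_realK. Qed.

Lemma to_real_norm_gt0 (a : K) : (0 < to_real `|a|) = (a != 0).
Proof. by rewrite -(@of_real_lt) of_real0 to_realK// normr_gt0. Qed.

Lemma to_real_normV (a : K) : to_real `|a^-1| = (to_real `|a|)^-1.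
Proof.
apply: of_real_inj; rewrite to_realK// normfV -{1}[`|a|]to_realK//.
by case: k (to_real _) => // r; rewrite /= fmorphV.
Qed.

Section rnorm.
Context {E : normedModType K}.
Implicit Types x y : E.

Definition rnorm x : R := to_real `|x|.

Lemma of_real_rnorm x : of_real (rnorm x) = `|x|.
Proof. exact: to_realK. Qed.

Lemma rnorm_ge0 x : 0 <= rnorm x.
Proof. by rewrite -(@of_real_le) of_real_rnorm of_real0. Qed.

Lemma rnorm0 : rnorm 0 = 0.
Proof. by apply: of_real_inj; rewrite of_real_rnorm of_real0 normr0. Qed.

Lemma rnorm0_eq0 x : rnorm x = 0 -> x = 0.
Proof.
by move=> x0; apply/normr0_eq0; rewrite -of_real_rnorm x0 of_real0.
Qed.

Lemma ler_rnormD x y : rnorm (x + y) <= rnorm x + rnorm y.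
Proof. by rewrite -of_real_le of_realD !of_real_rnorm ler_normD. Qed.

Lemma rnormN x : rnorm (- x) = rnorm x.
Proof. by rewrite /rnorm normrN. Qed.

Lemma rnormB x y : rnorm (x - y) = rnorm (y - x).
Proof. by rewrite /rnorm distrC. Qed.

Lemma rnormZ (a : K) x : rnorm (a *: x) = to_real `|a| * rnorm x.
Proof.
by apply: of_real_inj; rewrite of_realM to_realK// !of_real_rnorm normrZ.
Qed.

End rnorm.
End scalars.

Section least_constant.
Context {R : realType}.
Variables (J : Type) (a w : J -> R).
Hypothesis w0 : forall j, 0 <= w j.
Let S := [set C : R | 0 <= C /\ forall j, a j <= C * w j].

Lemma inf_least_constant : S !=set0 -> S (inf S).
Proof.
move=> S0; have iS0 : 0 <= inf S by apply: lb_le_inf => // C [].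
split => // j; have := w0 j; rewrite le_eqVlt => /predU1P[w0j|wj].
  by case: S0 => C [_ /(_ j)]; rewrite -w0j !mulr0.
rewrite -ler_pdivrMr//; apply: lb_le_inf => // C [_ /(_ j)].
by rewrite -ler_pdivrMr.
Qed.
End least_constant.

(* The distinguished base point of a pointed metric space is [point]. *)
#[short(type="pmetricType")]
HB.structure Definition PointedMetric (R : numDomainType) :=
  {T of Metric R T & isPointed T}.

Section lip0_def.
Context {R : realType} {k : scalar_kind}.
Local Notation K := (scalar_field R k).
Variables (X : pmetricType R) (E : normedModType K).

(* The sign condition keeps the infimum [Lip] nonnegative on one-point spaces,
   where every real number bounds all the difference quotients. *)
Definition lip_bound (f : X -> E) (C : R) : Prop :=
  0 <= C /\ forall x x', rnorm (f x - f x') <= C * mdist x x'.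

Definition is_lip0 (f : X -> E) : Prop :=
  f point = 0 /\ exists C, lip_bound f C.

Definition lip0_pred : {pred X -> E} := fun f => `[< is_lip0 f >].

Record Lip0 := MkLip0 { lip0_fun :> X -> E ; lip0_funP : lip0_fun \in lip0_pred }.

HB.instance Definition _ := [isSub for lip0_fun].
HB.instance Definition _ := [Choice of Lip0 by <:].

Definition mk_lip0 (f : X -> E) (hf : is_lip0 f) : Lip0 :=
  MkLip0 (asboolT hf : f \in lip0_pred).

Definition Lip (f : X -> E) : R := inf [set C | lip_bound f C].

Lemma lip_boundD f g C D : lip_bound f C -> lip_bound g D ->
  lip_bound (f + g) (C + D).
Proof.
move=> [C0 fC] [D0 gD]; split; first exact: addr_ge0.
move=> x x'; rewrite opprD addrACA mulrDl.
by rewrite (le_trans (ler_rnormD _ _))// lerD.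
Qed.

Lemma lip_boundZ (a : K) f C : lip_bound f C ->
  lip_bound (a *: f) (to_real `|a| * C).
Proof.
have a0 := to_real_norm_ge0 a.
move=> [C0 fC]; split; first exact: mulr_ge0.
by move=> x x'; rewrite -scalerBr rnormZ -mulrA ler_wpM2l.
Qed.

Lemma lip0_submod_closed : submod_closed lip0_pred.
Proof.
split.
  apply/asboolP; split => //; exists 0; split => // x x'.
  by rewrite subr0 rnorm0 mul0r.
move=> a f g /asboolP[f0 [C fC]] /asboolP[g0 [D gD]].
apply/asboolP; split.
  have -> : (a *: f + g) point = a *: f point + g point by [].
  by rewrite f0 g0 scaler0 addr0.
by exists (to_real `|a| * C + D); apply: lip_boundD => //; exact: lip_boundZ.
Qed.

HB.instance Definition _ :=
  GRing.isSubmodClosed.Build _ _ lip0_pred lip0_submod_closed.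
HB.instance Definition _ := [SubChoice_isSubLmodule of Lip0 by <:].

Lemma lip0P (f : Lip0) : is_lip0 f.
Proof. by case: f => f /= /asboolP. Qed.

Lemma lip0_point (f : Lip0) : f point = 0.
Proof. by case: (lip0P f). Qed.

Lemma Lip_le (f : X -> E) C : lip_bound f C -> Lip f <= C.
Proof. by move=> fC; apply: ge_inf => //; exists 0 => D []. Qed.

Lemma Lip_bound (f : Lip0) : lip_bound f (Lip f).
Proof.
have [_ [C [C0 fC]]] := lip0P f.
have LE : [set C | lip_bound f C] = [set C | 0 <= C /\
    forall p : X * X, rnorm (f p.1 - f p.2) <= C * mdist p.1 p.2].
  apply/seteqP; split => D /= [D0 h]; split => //.
  by move=> x x'; exact: (h (x, x')).
have := @inf_least_constant R (X * X)%type
  (fun p => rnorm (f p.1 - f p.2)) (fun p => mdist p.1 p.2)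
  (fun p => mdist_ge0 _ _).
rewrite /Lip LE => /(_ _)[|D0 h].
  by exists C; split => // p; exact: fC.
by split => // x x'; exact: (h (x, x')).
Qed.

Lemma Lip_ge0 (f : Lip0) : 0 <= Lip f.
Proof. by case: (Lip_bound f). Qed.

Definition lip_norm (f : Lip0) : K := of_real (Lip f).

Let lip_normD f g : lip_norm (f + g) <= lip_norm f + lip_norm g.
Proof.
by rewrite -of_realD of_real_le; apply/Lip_le/lip_boundD; exact: Lip_bound.
Qed.

Let LipZ_le a (f : Lip0) : Lip (a *: f : Lip0) <= to_real `|a| * Lip f.
Proof. by apply/Lip_le/lip_boundZ; exact: Lip_bound. Qed.

Let lip_normZ a f : lip_norm (a *: f) = `|a| * lip_norm f.
Proof.
rewrite -[`|a|](@to_realK R k)// -of_realM; congr of_real.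
apply/eqP; rewrite eq_le LipZ_le andTb.
have [->|a0] := eqVneq a 0.
  rewrite normr0 -[in leLHS](@of_real0 R k) of_realK mul0r; exact: Lip_ge0.
rewrite mulrC -ler_pdivlMr ?to_real_norm_gt0// -{1}(scalerK a0 f).
by rewrite (le_trans (LipZ_le _ _))// to_real_normV mulrC.
Qed.

Let lip_norm0 f : lip_norm f = 0 -> f = 0.
Proof.
rewrite -(@of_real0 R k) => /of_real_inj f0.
apply/val_inj/funext => x; apply/rnorm0_eq0/eqP.
rewrite eq_le rnorm_ge0 andbT.
by have [_ /(_ x point)] := Lip_bound f; rewrite lip0_point subr0 f0 mul0r.
Qed.

HB.instance Definition _ :=
  Lmodule_isNormed.Build K Lip0 lip_normD lip_normZ lip_norm0.

Lemma rnorm_Lip (f : Lip0) : rnorm f = Lip f.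
Proof. exact: of_realK. Qed.
End lip0_def.
Arguments Lip0 {R k}.

Section lip0_complete.
Context {R : realType} {k : scalar_kind}.
Local Notation K := (scalar_field R k).
Variables (X : pmetricType R) (E : completeNormedModType K).

Let rnorm_eval (f g : Lip0 X E) x :
  rnorm (f x - g x) <= rnorm (f - g) * mdist x point.
Proof.
rewrite rnorm_Lip; have [_ /(_ x point)] := Lip_bound (f - g).
by rewrite lip0_point subr0.
Qed.

Let lip0_cauchy_cvg (F : set_system (Lip0 X E)) :
  ProperFilter F -> cauchy F -> cvg F.
Proof.
move=> FF /cauchyP Fc.
have Fe e : 0 < e -> exists f0, F [set f | rnorm (f0 - f) < e].
  move=> e0; have [|f0 Ff0] := Fc (of_real e); first by rewrite -of_real0 of_real_lt.
  exists f0; apply: filterS Ff0 => f.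
  by rewrite -ball_normE /= -of_real_rnorm of_real_lt.
have evcvg x : cvg ((fun f : Lip0 X E => f x) @ F).
  apply: cauchy_cvg; apply/cauchy_exP => e e0.
  have d0 : 0 <= mdist x point :> R by exact: mdist_ge0.
  have r0 : 0 < to_real e by rewrite -(@of_real_lt _ k) of_real0 to_realK// ltW.
  have [|f0 Ff0] := Fe (to_real e / (mdist x point + 1)).
    by rewrite divr_gt0// ltr_wpDl.
  exists (f0 x); suff: F [set f : Lip0 X E | ball (f0 x) e (f x)] by [].
  apply: filterS Ff0 => f /= f0f.
  rewrite -ball_normE /= -of_real_rnorm -[e]to_realK ?ltW// of_real_lt.
  apply: le_lt_trans (rnorm_eval f0 f x) _.
  apply: (@le_lt_trans _ _ (rnorm (f0 - f) * (mdist x point + 1))).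
    by rewrite ler_wpM2l ?rnorm_ge0// lerDl.
  by rewrite -ltr_pdivlMr// ltr_wpDl.
pose g x : E := lim ((fun f : Lip0 X E => f x) @ F).
have gE x e : 0 < e -> F [set f : Lip0 X E | rnorm (g x - f x) < e].
  move=> e0; have e'0 : 0 < of_real e :> K by rewrite -of_real0 of_real_lt.
  have /cvgrPdist_lt/(_ _ e'0) := evcvg x.
  by apply: filterS => f /=; rewrite -of_real_rnorm of_real_lt.
have key f0 e : F [set f | rnorm (f0 - f) < e] ->
    forall x x', rnorm ((f0 x - g x) - (f0 x' - g x')) <= e * mdist x x'.
  move=> Ff0 x x'; apply/ler_addgt0Pr => d d0.
  have d20 : 0 < d / 2 by rewrite divr_gt0.
  have [f [[/= f0f gx] gx']] :=
    filter_ex (filterI (filterI Ff0 (gE x _ d20)) (gE x' _ d20)).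
  have -> : f0 x - g x - (f0 x' - g x') =
      ((f0 - f) x - (f0 - f) x') + (- (g x - f x) + (g x' - f x')).
    have hE y : (f0 - f) y = f0 y - f y by [].
    have sE (u v w : E) : u - v = (u - w) - (v - w) by rewrite opprB addrA subrK.
    rewrite !hE (sE (f0 x) (g x) (f x)) (sE (f0 x') (g x') (f x')).
    have aE (a b c d' : E) : a - b - (c - d') = (a - c) + (- b + d').
      by rewrite opprB [d' - c]addrC addrACA.
    exact: aE.
  rewrite (le_trans (ler_rnormD _ _))// lerD//.
    apply: le_trans ((Lip_bound (f0 - f)).2 x x') _.
    by rewrite ler_wpM2r ?mdist_ge0// -rnorm_Lip ltW.
  rewrite (le_trans (ler_rnormD _ _))// rnormN [leRHS]splitr.
  by rewrite lerD// ltW.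
have g_lip0 : is_lip0 g.
  split.
    apply/rnorm0_eq0/eqP; rewrite eq_le rnorm_ge0 andbT.
    apply/ler_addgt0Pl => d d0; rewrite addr0.
    have [f /=] := filter_ex (gE point _ d0).
    by rewrite lip0_point subr0 => /ltW.
  have [f0 Ff0] := Fe 1 ltr01.
  have [f00 f0b] := Lip_bound f0.
  exists (1 + Lip f0); split; first by rewrite addr_ge0.
  move=> x x'; have -> : g x - g x' =
      - ((f0 x - g x) - (f0 x' - g x')) + (f0 x - f0 x').
    by rewrite opprD opprK addrACA opprB subrK addrAC subrr sub0r.
  rewrite mulrDl (le_trans (ler_rnormD _ _))// rnormN lerD//.
  exact: key.
apply/cvg_ex; exists (mk_lip0 g_lip0); apply/cvgrPdist_lt => e e0.
have r0 : 0 < to_real e by rewrite -(@of_real_lt _ k) of_real0 to_realK// ltW.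
have r20 : 0 < to_real e / 2 by rewrite divr_gt0.
have [f0 Ff0] := Fe _ r20.
apply: filterS (Ff0) => f /= f0f.
rewrite -of_real_rnorm -[e]to_realK ?ltW// of_real_lt.
have -> : mk_lip0 g_lip0 - f = - (f0 - mk_lip0 g_lip0) + (f0 - f).
  by rewrite opprB addrA subrK.
rewrite (le_lt_trans (ler_rnormD _ _))// rnormN [ltRHS]splitr ler_ltD//.
rewrite rnorm_Lip; apply: Lip_le; split; first exact: ltW.
exact: key.
Qed.

HB.instance Definition _ :=
  Uniform_isComplete.Build (Lip0 X E) lip0_cauchy_cvg.
End lip0_complete.


Section blip0_def.
Context {R : realType} {k : scalar_kind}.
Local Notation K := (scalar_field R k).
Variables (X1 X2 : pmetricType R) (E : normedModType K).

Definition diff2 (T : X1 * X2 -> E) (x1 x1' : X1) (x2 x2' : X2) : E :=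
  T (x1, x2) - T (x1, x2') - T (x1', x2) + T (x1', x2').

Definition blip_bound (T : X1 * X2 -> E) (C : R) : Prop :=
  0 <= C /\ forall x1 x1' x2 x2',
    rnorm (diff2 T x1 x1' x2 x2') <= C * (mdist x1 x1' * mdist x2 x2').

Definition is_blip0 (T : X1 * X2 -> E) : Prop :=
  [/\ forall x1, T (x1, point) = 0, forall x2, T (point, x2) = 0 &
      exists C, blip_bound T C].

Definition blip0_pred : {pred X1 * X2 -> E} := fun T => `[< is_blip0 T >].

Record BLip0 := MkBLip0 {
  blip0_fun :> X1 * X2 -> E ; blip0_funP : blip0_fun \in blip0_pred }.

HB.instance Definition _ := [isSub for blip0_fun].
HB.instance Definition _ := [Choice of BLip0 by <:].

Definition BLip (T : X1 * X2 -> E) : R := inf [set C | blip_bound T C].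

Let diff2D T U x1 x1' x2 x2' : diff2 (T + U) x1 x1' x2 x2' =
  diff2 T x1 x1' x2 x2' + diff2 U x1 x1' x2 x2'.
Proof.
have DE p : (T + U) p = T p + U p by [].
by rewrite /diff2 !DE !opprD (addrACA (T _)) (addrACA (T _ - _)) (addrACA (T _ - _ - _)).
Qed.

Let diff2Z (a : K) T x1 x1' x2 x2' : diff2 (a *: T) x1 x1' x2 x2' =
  a *: diff2 T x1 x1' x2 x2'.
Proof.
have ZE p : (a *: T) p = a *: T p by [].
by rewrite /diff2 !ZE scalerDr !scalerBr.
Qed.

Lemma blip_boundD T U C D : blip_bound T C -> blip_bound U D ->
  blip_bound (T + U) (C + D).
Proof.
move=> [C0 TC] [D0 UD]; split; first exact: addr_ge0.
move=> x1 x1' x2 x2'; rewrite diff2D mulrDl.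
by rewrite (le_trans (ler_rnormD _ _))// lerD.
Qed.

Lemma blip_boundZ (a : K) T C : blip_bound T C ->
  blip_bound (a *: T) (to_real `|a| * C).
Proof.
have a0 := to_real_norm_ge0 a.
move=> [C0 TC]; split; first exact: mulr_ge0.
by move=> x1 x1' x2 x2'; rewrite diff2Z rnormZ -mulrA ler_wpM2l.
Qed.

Lemma blip0_submod_closed : submod_closed blip0_pred.
Proof.
split.
  apply/asboolP; split => //; exists 0; split => // x1 x1' x2 x2'.
  by rewrite /diff2 !subr0 addr0 rnorm0 mul0r.
move=> a T U /asboolP[T1 T2 [C TC]] /asboolP[U1 U2 [D UD]].
have LE p : (a *: T + U) p = a *: T p + U p by [].
apply/asboolP; split => [x1|x2|].
- by rewrite LE T1 U1 scaler0 addr0.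
- by rewrite LE T2 U2 scaler0 addr0.
- by exists (to_real `|a| * C + D); apply: blip_boundD => //; exact: blip_boundZ.
Qed.

HB.instance Definition _ :=
  GRing.isSubmodClosed.Build _ _ blip0_pred blip0_submod_closed.
HB.instance Definition _ := [SubChoice_isSubLmodule of BLip0 by <:].

Lemma blip0P (T : BLip0) : is_blip0 T.
Proof. by case: T => T /= /asboolP. Qed.

Lemma blip0_pointr (T : BLip0) x1 : T (x1, point) = 0.
Proof. by case: (blip0P T). Qed.

Lemma blip0_pointl (T : BLip0) x2 : T (point, x2) = 0.
Proof. by case: (blip0P T). Qed.

Lemma diff2_pointl (T : BLip0) x1 x2 x2' :
  diff2 T x1 point x2 x2' = T (x1, x2) - T (x1, x2').
Proof. by rewrite /diff2 !blip0_pointl subr0 addr0. Qed.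

Lemma diff2_pointr (T : BLip0) x1 x1' x2 :
  diff2 T x1 x1' x2 point = T (x1, x2) - T (x1', x2).
Proof. by rewrite /diff2 !blip0_pointr subr0 addr0. Qed.

Lemma BLip_le (T : X1 * X2 -> E) C : blip_bound T C -> BLip T <= C.
Proof. by move=> TC; apply: ge_inf => //; exists 0 => D []. Qed.

Lemma BLip_bound (T : BLip0) : blip_bound T (BLip T).
Proof.
have [_ _ [C [C0 TC]]] := blip0P T.
pose a (p : X1 * X1 * X2 * X2) := rnorm (diff2 T p.1.1.1 p.1.1.2 p.1.2 p.2).
pose w (p : X1 * X1 * X2 * X2) : R :=
  mdist p.1.1.1 p.1.1.2 * mdist p.1.2 p.2.
have BE : [set C | blip_bound T C] =
    [set C | 0 <= C /\ forall p, a p <= C * w p].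
  apply/seteqP; split => D /= [D0 h]; split => //.
    by move=> p; exact: h.
  by move=> x1 x1' x2 x2'; exact: (h (x1, x1', x2, x2')).
have w0 p : 0 <= w p by rewrite mulr_ge0// mdist_ge0.
have := @inf_least_constant R _ a w w0.
rewrite /BLip BE => /(_ _)[|D0 h].
  by exists C; split => // p; exact: TC.
by split => // x1 x1' x2 x2'; exact: (h (x1, x1', x2, x2')).
Qed.

Lemma BLip_ge0 (T : BLip0) : 0 <= BLip T.
Proof. by case: (BLip_bound T). Qed.

Definition blip_norm (T : BLip0) : K := of_real (BLip T).

Let blip_normD T U : blip_norm (T + U) <= blip_norm T + blip_norm U.
Proof.
by rewrite -of_realD of_real_le; apply/BLip_le/blip_boundD; exact: BLip_bound.
Qed.

Let BLipZ_le a (T : BLip0) : BLip (a *: T : BLip0) <= to_real `|a| * BLip T.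
Proof. by apply/BLip_le/blip_boundZ; exact: BLip_bound. Qed.

Let blip_normZ a T : blip_norm (a *: T) = `|a| * blip_norm T.
Proof.
rewrite -[`|a|](@to_realK R k)// -of_realM; congr of_real.
apply/eqP; rewrite eq_le BLipZ_le andTb.
have [->|a0] := eqVneq a 0.
  rewrite normr0 -[in leLHS](@of_real0 R k) of_realK mul0r; exact: BLip_ge0.
rewrite mulrC -ler_pdivlMr ?to_real_norm_gt0// -{1}(scalerK a0 T).
by rewrite (le_trans (BLipZ_le _ _))// to_real_normV mulrC.
Qed.

Let blip_norm0 T : blip_norm T = 0 -> T = 0.
Proof.
rewrite -(@of_real0 R k) => /of_real_inj T0.
apply/val_inj/funext => -[x1 x2]; apply/rnorm0_eq0/eqP.
rewrite eq_le rnorm_ge0 andbT.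
have [_ /(_ x1 point x2 point)] := BLip_bound T.
by rewrite diff2_pointl blip0_pointr subr0 T0 mul0r.
Qed.

HB.instance Definition _ :=
  Lmodule_isNormed.Build K BLip0 blip_normD blip_normZ blip_norm0.

Lemma rnorm_BLip (T : BLip0) : rnorm T = BLip T.
Proof. exact: of_realK. Qed.
End blip0_def.
Arguments BLip0 {R k}.

Section associated.
Context {R : realType} {k : scalar_kind}.
Local Notation K := (scalar_field R k).
Variables (X1 X2 : pmetricType R) (E : normedModType K) (T : BLip0 X1 X2 E).

Lemma curry1_lip0 x1 : is_lip0 (fun x2 => T (x1, x2)).
Proof.
split; first exact: blip0_pointr.
have [B0 TB] := BLip_bound T.
exists (BLip T * mdist x1 point); split; first by rewrite mulr_ge0// mdist_ge0.
by move=> x2 x2'; rewrite -mulrA -diff2_pointl.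
Qed.

Lemma curry2_lip0 x2 : is_lip0 (fun x1 => T (x1, x2)).
Proof.
split; first exact: blip0_pointl.
have [B0 TB] := BLip_bound T.
exists (BLip T * mdist x2 point); split; first by rewrite mulr_ge0// mdist_ge0.
by move=> x1 x1'; rewrite mulrAC -mulrA -diff2_pointr.
Qed.

Definition curry1 (x1 : X1) : Lip0 X2 E := mk_lip0 (curry1_lip0 x1).
Definition curry2 (x2 : X2) : Lip0 X1 E := mk_lip0 (curry2_lip0 x2).

Lemma assoc1_lip0 : is_lip0 curry1.
Proof.
have [B0 TB] := BLip_bound T.
split; first by apply/val_inj/funext => x2; exact: blip0_pointl.
exists (BLip T); split => // x1 x1'.
rewrite rnorm_Lip; apply: Lip_le; split.
  by rewrite mulr_ge0// mdist_ge0.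
move=> x2 x2'; have -> : (curry1 x1 - curry1 x1') x2 -
    (curry1 x1 - curry1 x1') x2' = diff2 T x1 x1' x2 x2'.
  have cE y : (curry1 x1 - curry1 x1') y = T (x1, y) - T (x1', y) by [].
  by rewrite !cE opprB [_ - T (x1, x2')]addrC addrACA addrA.
by rewrite -mulrA.
Qed.

Lemma assoc2_lip0 : is_lip0 curry2.
Proof.
have [B0 TB] := BLip_bound T.
split; first by apply/val_inj/funext => x1; exact: blip0_pointr.
exists (BLip T); split => // x2 x2'.
rewrite rnorm_Lip; apply: Lip_le; split.
  by rewrite mulr_ge0// mdist_ge0.
move=> x1 x1'; have -> : (curry2 x2 - curry2 x2') x1 -
    (curry2 x2 - curry2 x2') x1' = diff2 T x1 x1' x2 x2'.
  have cE y : (curry2 x2 - curry2 x2') y = T (y, x2) - T (y, x2') by [].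
  by rewrite !cE opprB [T (x1', x2') - _]addrC addrA.
by rewrite mulrAC -mulrA.
Qed.

Definition assoc1 : Lip0 X1 (Lip0 X2 E) := mk_lip0 assoc1_lip0.
Definition assoc2 : Lip0 X2 (Lip0 X1 E) := mk_lip0 assoc2_lip0.
End associated.

Record LipMap (R : realType) (Y X : pmetricType R) := MkLipMap {
  lipmap_fun :> Y -> X ;
  lipmap_point : lipmap_fun point = point ;
  lipmap_bounded : exists C, forall y y',
    mdist (lipmap_fun y) (lipmap_fun y') <= C * mdist y y' }.

Record BoundedOp (R : realType) (k : scalar_kind)
    (E F : normedModType (scalar_field R k)) := MkBoundedOp {
  bop_fun :> {linear E -> F} ;
  bop_bounded : exists C : R, forall x, rnorm (bop_fun x) <= C * rnorm x }.

Section lip0_constructions.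
Context {R : realType} {k : scalar_kind}.
Local Notation K := (scalar_field R k).

Lemma lip0_rank1_subproof (X : pmetricType R) (E : normedModType K)
  (g : Lip0 X K^o) (v : E) : is_lip0 (fun x => (g x : K) *: v).
Proof.
split; first by rewrite lip0_point scale0r.
have [B0 gB] := Lip_bound g.
exists (Lip g * rnorm v); split; first by rewrite mulr_ge0 ?rnorm_ge0.
move=> x x'; rewrite -scalerBl rnormZ mulrAC ler_wpM2r ?rnorm_ge0//.
exact: gB.
Qed.

Definition lip0_rank1 (X : pmetricType R) (E : normedModType K)
    (g : Lip0 X K^o) (v : E) : Lip0 X E :=
  mk_lip0 (lip0_rank1_subproof g v).

Lemma lip0_comp_subproof (Y X : pmetricType R) (E F : normedModType K)
  (w : BoundedOp E F) (T : Lip0 X E) (S : LipMap Y X) :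
  is_lip0 (fun y => w (T (S y))).
Proof.
split; first by rewrite lipmap_point lip0_point linear0.
have [T0 TB] := Lip_bound T.
have [C SC] := lipmap_bounded S; have [D wD] := bop_bounded w.
exists (`|D| * (Lip T * `|C|)); split; first by rewrite !mulr_ge0.
move=> y y'; rewrite -linearB (le_trans (wD _))//.
rewrite (@le_trans _ _ (`|D| * rnorm (T (S y) - T (S y'))))//.
  by rewrite ler_wpM2r ?rnorm_ge0 ?ler_norm.
rewrite -mulrA ler_wpM2l// (le_trans (TB _ _))// -mulrA ler_wpM2l//.
by rewrite (le_trans (SC _ _))// ler_wpM2r ?mdist_ge0 ?ler_norm.
Qed.

Definition lip0_comp (Y X : pmetricType R) (E F : normedModType K)
    (w : BoundedOp E F) (T : Lip0 X E) (S : LipMap Y X) : Lip0 Y F :=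
  mk_lip0 (lip0_comp_subproof w T S).
End lip0_constructions.

Section classes.
Variables (R : realType) (k : scalar_kind).
Local Notation K := (scalar_field R k).

(* Subclasses of Lip_0 and of the two-Lipschitz operators, given by their
   components, with no closure property imposed. *)
Definition lip_class :=
  forall (X : pmetricType R) (E : completeNormedModType K), set (Lip0 X E).

Definition blip_class :=
  forall (X1 X2 : pmetricType R) (E : completeNormedModType K),
    set (BLip0 X1 X2 E).

Record lip_ideal (I : lip_class) : Prop := {
  lip_ideal0 : forall X E, I X E 0 ;
  lip_idealD : forall X (E : completeNormedModType K) (S T : Lip0 X E),
    I X E S -> I X E T -> I X E (S + T) ;
  lip_idealZ : forall X (E : completeNormedModType K) (a : K) (T : Lip0 X E),
    I X E T -> I X E (a *: T) ;
  lip_ideal_rank1 : forall X (E : completeNormedModType K)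
    (g : Lip0 X K^o) (v : E), I X E (lip0_rank1 g v) ;
  lip_ideal_comp : forall Y X (E F : completeNormedModType K)
    (w : BoundedOp E F) (T : Lip0 X E) (S : LipMap Y X),
    I X E T -> I Y F (lip0_comp w T S) }.

Definition lip_closure (I : lip_class) : lip_class :=
  fun X E => closure (I X E).
Arguments lip_closure I X E _ : clear implicits.

Definition blip_closure (I : blip_class) : blip_class :=
  fun X1 X2 E => closure (I X1 X2 E).
Arguments blip_closure I X1 X2 E _ : clear implicits.

Definition lip_closed (I : lip_class) : Prop :=
  forall X E, lip_closure I X E = I X E.

Definition blip_closed (I : blip_class) : Prop :=
  forall X1 X2 E, blip_closure I X1 X2 E = I X1 X2 E.

Definition blip_sub (I J : blip_class) : Prop :=
  forall X1 X2 E, I X1 X2 E `<=` J X1 X2 E.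

Definition lip_bracket (I1 I2 : lip_class) : blip_class :=
  fun X1 X2 E => [set T : BLip0 X1 X2 E |
    I1 X1 (Lip0 X2 E) (assoc1 T) /\ I2 X2 (Lip0 X1 E) (assoc2 T)].
End classes.
Arguments lip_closure {R k} I X E _.
Arguments blip_closure {R k} I X1 X2 E _.
Arguments lip_bracket {R k} I1 I2 X1 X2 E _.

(* Main.v *)
Require Import Defs.
From HB Require Import structures.
From mathcomp Require Import all_boot all_order all_algebra.
From mathcomp Require Import all_classical all_reals all_analysis.

(** Passing from a two-Lipschitz operator to an associated map is linear and
    does not increase norms. The increment of the Lipschitz map
    [curry1 T x1 - curry1 T x1'] between two points is a mixed second
    difference of [T], so this map has norm at most [BLip T * mdist x1 x1'],
    that is, [Lip (assoc1 T) <= BLip T]; the second variable is symmetric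
    ([Lip_assoc1], [Lip_assoc2]). Applied to differences of operators, this
    makes [assoc1] and [assoc2] nonexpansive, hence continuous, so that they
    map a limit of operators of the bracket to limits of members of the two
    ideals ([nonexpansive_closure]): this is the inclusion.

    When both ideals are closed, the right-hand side of the inclusion is the
    bracket itself, which therefore contains its closure. *)

Set Implicit Arguments.
Unset Strict Implicit.
Unset Printing Implicit Defensive.

Import Order.TTheory GRing.Theory Num.Theory.
Import numFieldNormedType.Exports.

Local Open Scope classical_set_scope.
Local Open Scope ring_scope.

Section associated_maps.
Context {R : realType} {k : scalar_kind}.
Variables (X1 X2 : pmetricType R) (E : normedModType (scalar_field R k)).
Implicit Types T U : BLip0 X1 X2 E.

Lemma curry1B_increment T x1 x1' x2 x2' :
  (curry1 T x1 - curry1 T x1') x2 - (curry1 T x1 - curry1 T x1') x2' =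
  diff2 T x1 x1' x2 x2'.
Proof.
have cE y : (curry1 T x1 - curry1 T x1') y = T (x1, y) - T (x1', y) by [].
by rewrite !cE /diff2 opprB [_ - T (x1, x2')]addrC addrACA addrA.
Qed.

Lemma curry2B_increment T x1 x1' x2 x2' :
  (curry2 T x2 - curry2 T x2') x1 - (curry2 T x2 - curry2 T x2') x1' =
  diff2 T x1 x1' x2 x2'.
Proof.
have cE y : (curry2 T x2 - curry2 T x2') y = T (y, x2) - T (y, x2') by [].
by rewrite !cE /diff2 opprB [T (x1', x2') - _]addrC addrA.
Qed.

(** [Lip] and [BLip] are infima of admissible constants, so it suffices that
    [BLip T], which is admissible for [T], is admissible for [assoc1 T]. The
    norm of an increment of [assoc1 T] is itself such an infimum. *)
Lemma Lip_assoc1 T : Lip (assoc1 T) <= BLip T.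
Proof.
have [B0 TB] := BLip_bound T.
apply: Lip_le; split => // x1 x1'.
rewrite rnorm_Lip; apply: Lip_le; split; first by rewrite mulr_ge0// mdist_ge0.
by move=> x2 x2'; rewrite [X in rnorm X]curry1B_increment -mulrA.
Qed.

Lemma Lip_assoc2 T : Lip (assoc2 T) <= BLip T.
Proof.
have [B0 TB] := BLip_bound T.
apply: Lip_le; split => // x2 x2'.
rewrite rnorm_Lip; apply: Lip_le; split; first by rewrite mulr_ge0// mdist_ge0.
by move=> x1 x1'; rewrite [X in rnorm X]curry2B_increment mulrAC -mulrA.
Qed.

Lemma assoc1B T U : assoc1 (T - U) = assoc1 T - assoc1 U.
Proof. by apply/val_inj/funext => x1; apply/val_inj/funext. Qed.

Lemma assoc2B T U : assoc2 (T - U) = assoc2 T - assoc2 U.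
Proof. by apply/val_inj/funext => x2; apply/val_inj/funext. Qed.

Lemma assoc1_nonexpansive T U :
  rnorm (assoc1 T - assoc1 U) <= rnorm (T - U).
Proof. by rewrite -assoc1B rnorm_Lip rnorm_BLip; exact: Lip_assoc1. Qed.

Lemma assoc2_nonexpansive T U :
  rnorm (assoc2 T - assoc2 U) <= rnorm (T - U).
Proof. by rewrite -assoc2B rnorm_Lip rnorm_BLip; exact: Lip_assoc2. Qed.

End associated_maps.

(** A nonexpansive map between normed spaces is continuous, and continuous maps
    preserve adherence. *)
Lemma nonexpansive_closure {R : realType} {k : scalar_kind}
    (V W : normedModType (scalar_field R k)) (f : V -> W)
    (A : set V) (B : set W) :
  (forall u v, rnorm (f u - f v) <= rnorm (u - v)) ->
  A `<=` f @^-1` B -> closure A `<=` f @^-1` closure B.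
Proof.
move=> f_le AB u Au; have fc : continuous_at u f.
  apply/cvgrPdist_lt => e e0; have /cvgrPdist_lt/(_ e e0) := @cvg_id _ (nbhs u).
  apply: filterS => v /=; apply: le_lt_trans.
  by rewrite -!of_real_rnorm of_real_le.
move=> N /fc /Au[v [Av Nv]].
by exists (f v); split => //; exact: AB.
Qed.

Theorem proposition5p4 (R : realType) (k : scalar_kind)
    (I1 I2 : lip_class R k) (hI1 : lip_ideal I1) (hI2 : lip_ideal I2) :
  blip_sub (blip_closure (lip_bracket I1 I2))
           (lip_bracket (lip_closure I1) (lip_closure I2)) /\
  (lip_closed I1 -> lip_closed I2 -> blip_closed (lip_bracket I1 I2)).
Proof.
have sub : blip_sub (blip_closure (lip_bracket I1 I2))
                    (lip_bracket (lip_closure I1) (lip_closure I2)).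
  move=> X1 X2 E T clT; split.
    apply: (nonexpansive_closure (f := @assoc1 _ _ X1 X2 E) _ _ clT).
      exact: assoc1_nonexpansive.
    by move=> U [].
  apply: (nonexpansive_closure (f := @assoc2 _ _ X1 X2 E) _ _ clT).
    exact: assoc2_nonexpansive.
  by move=> U [].
split => // cl1 cl2 X1 X2 E; apply/seteqP; split; last exact: subset_closure.
by move=> T /sub[]; rewrite cl1 cl2.
Qed.
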